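(* Let $0<q<1$. Let $\boldsymbol{k}=(k_1,\dots,k_r)$ be any index (a finite sequence of positive integers) such that $k_i\ge 2$ for some $i$. Then $$\sum_{i=1}^r \zeta_q(k_i+1,k_{i+1},\dots,k_r,k_1,\dots,k_{i-1}) = \sum_{i=1}^r\sum_{j=0}^{k_i-2}\zeta_q(k_i-j,k_{i+1},\dots,k_r,k_1,\dots,k_{i-1},j+1),$$ where the inner sum on the right is empty (equal to $0$) when $k_i=1$.
   Context: Fix $0<q<1$ and let $[n]:=\frac{1-q^n}{1-q}$. An index is a finite sequence of positive integers $(k_1,\dots,k_r)$; it is admissible if $k_1\ge 2$. For an admissible index, the $q$-multiple zeta value is the absolutely convergent series $$\zeta_q(k_1,\dots,k_r):=\sum_{n_1>n_2>\dots>n_r>0}\frac{q^{n_1(k_1-1)+n_2(k_2-1)+\cdots+n_r(k_r-1)}}{[n_1]^{k_1}[n_2]^{k_2}\cdots[n_r]^{k_r}}.$$ *)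

(* Defs.v *)
From mathcomp Require Import all_boot all_order all_algebra.
From mathcomp Require Import all_classical all_reals all_analysis.

Set Implicit Arguments.
Unset Strict Implicit.
Unset Printing Implicit Defensive.

Import Order.TTheory GRing.Theory Num.Theory.
Import numFieldNormedType.Exports.

Local Open Scope classical_set_scope.
Local Open Scope ring_scope.

Definition qnum (R : realType) (q : R) (n : nat) : R := (1 - q ^+ n) / (1 - q).

Definition is_index (k : seq nat) : bool := all (fun m => 0 < m)%N k.

(* The empty index has no first entry and is not admissible here. *)
Definition admissible (k : seq nat) : bool := is_index k && (2 <= head 0 k)%N.

Definition decreasing_seqs (r : nat) : set (seq nat) :=
  [set n | [/\ size n = r, sorted gtn n & all (fun m => 0 < m)%N n]].

Definition qmzv_term (R : realType) (q : R) (k n : seq nat) : R :=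
  q ^+ (\sum_(i < size k) nth 0 n i * (nth 0 k i - 1))%N
  / \prod_(i < size k) qnum q (nth 0%N n i) ^+ nth 0%N k i.

(* For 0 < q < 1 all terms over decreasing_seqs are nonnegative, so [esum] is
   the unordered sum; by [qmzv_summable] it is finite when k is admissible, and
   [fine] loses nothing.  For other k the value may be meaningless. *)
Definition qmzv (R : realType) (q : R) (k : seq nat) : R :=
  fine (\esum_(n in decreasing_seqs (size k)) (qmzv_term q k n)%:E)%E.

Section Summability.
Variable R : realType.

Lemma esum_le_scale (T : choiceType) (I : set T) (f : T -> R) (c C : R) :
  0 <= c -> (\esum_(i in I) (f i)%:E <= C%:E)%E ->
  (\esum_(i in I) (c * f i)%:E <= (c * C)%:E)%E.
Proof.
move=> c0 fC; apply: ge_ereal_sup => _ [X [finX XI] <-].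
rewrite fsumEFin// lee_fin -mulr_fsumr ler_wpM2l// -lee_fin -fsumEFin//.
by apply: le_trans fC; apply: ereal_sup_ubound; exists X.
Qed.

Lemma esum_geometric_fin (s : R) : 0 < s < 1 ->
  exists C : R, (\esum_(m in [set: nat]) (s ^+ m)%:E <= C%:E)%E.
Proof.
move=> /andP[s0 s1]; exists (1 / (1 - s)).
rewrite -nneseries_esumT => [|n]; last by rewrite lee_fin exprn_ge0// ltW.
apply: lime_le.
  by apply: is_cvg_nneseries => n _ _; rewrite lee_fin exprn_ge0// ltW.
apply: nearW => n; rewrite sumEFin lee_fin.
have := @geometric_seriesE R 1 s (negbT (lt_eqF s1)) => /(congr1 (fun f => f n)).
rewrite /series /=; under eq_bigr do rewrite mul1r.
move=> ->; rewrite mul1r ler_wpM2r ?invr_ge0 ?subr_ge0 ?(ltW s1)//.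
by rewrite gerBl exprn_ge0// ltW.
Qed.

Lemma esum_head_fin (r : nat) (t : R) : 0 < t < 1 ->
  exists C : R, (\esum_(n in decreasing_seqs r.+1) (t ^+ head 0 n)%:E <= C%:E)%E.
Proof.
elim: r t => [|r IH] t t01.
  have [C HC] := esum_geometric_fin t01; exists C.
  apply: le_trans HC.
  rewrite (@reindex_esum _ _ _ [set m | (0 < m)%N] _ (fun m => [:: m])); last first.
    split.
    - by move=> m /= m0; split=> //=; rewrite m0.
    - by move=> m1 m2 _ _ [].
    - by move=> [|m [|? ?]] [] //= _ _ /andP[m0 _]; exists m.
  rewrite [leRHS](esumID [set m | (0 < m)%N]); last first.
    by move=> m _; rewrite lee_fin exprn_ge0//; case/andP: t01 => /ltW.
  rewrite setTI /= leeDl// esum_ge0// => m _.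
  by rewrite lee_fin exprn_ge0//; case/andP: t01 => /ltW.
have /andP[t0 t1] := t01.
pose s := Num.sqrt t.
have s0 : 0 < s by rewrite sqrtr_gt0.
have s2 : s ^+ 2 = t by rewrite sqr_sqrtr// ltW.
have s1 : s < 1 by rewrite -(@ltr_pXn2r _ 2)// ?nnegrE ?ltW// s2 expr1n.
have s01 : 0 < s < 1 by rewrite s0.
have [C HC] := IH s s01; have [C' HC'] := esum_geometric_fin s01.
have C0 : 0 <= C.
  rewrite -lee_fin; apply: le_trans HC; apply: esum_ge0 => n _.
  by rewrite lee_fin exprn_ge0// ltW.
exists (C * C').
pose J (m : nat) := [set n | decreasing_seqs r.+1 n /\ (head 0 n < m)%N].
rewrite (@reindex_esum _ _ _ ([set: nat] `*`` J) _ (fun p => p.1 :: p.2)); last first.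
  split.
  - move=> [m [|a n]] /= [_ [[//= sz so al] am]]; split=> //=; first by rewrite sz.
      by rewrite am.
    by rewrite al (leq_ltn_trans (leq0n _) am).
  - by move=> [m n] [m' n'] _ _ /= [-> ->].
  - move=> [|m [|a n]] [] //= [sz] /andP[am so] /and3P[m0 a0 al].
    exists (m, a :: n) => //; split=> //=; split=> //; split=> //=.
    - by rewrite sz.
    - by rewrite a0.
rewrite -(@esum_esum _ _ _ _ _ (fun m n => (t ^+ head 0 (m :: n))%:E)); last first.
  by move=> m n _ _; rewrite lee_fin exprn_ge0// ltW.
apply: le_trans (esum_le_scale C0 HC').
apply: le_esum => m _.
apply: (@le_trans _ _ (\esum_(n in J m) (s ^+ m * s ^+ head 0 n)%:E)%E).
  apply: le_esum => n [_ nm] /=; rewrite lee_fin -s2 -exprM mul2n -addnn exprD.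
  by rewrite ler_wpM2l ?exprn_ge0 ?(ltW s0)// ler_wiXn2l ?(ltW s0) ?(ltW s1)// ltnW.
rewrite [(C * _)]mulrC; apply: esum_le_scale; first by rewrite exprn_ge0 ?ltW.
apply: le_trans HC.
rewrite [leRHS](esumID [set n | (head 0 n < m)%N]); last first.
  by move=> n _; rewrite lee_fin exprn_ge0// ltW.
rewrite leeDl// esum_ge0// => n _; by rewrite lee_fin exprn_ge0// ltW.
Qed.

Lemma qmzv_term_bound (q : R) (k n : seq nat) : 0 < q < 1 -> admissible k ->
  decreasing_seqs (size k) n -> 0 <= qmzv_term q k n <= q ^+ head 0 n.
Proof.
move=> /andP[q0 q1] /andP[_ k2] [sz _ npos].
have D1 : 1 <= \prod_(i < size k) qnum q (nth 0%N n i) ^+ nth 0%N k i.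
  apply: (big_ind (fun x : R => 1 <= x)) => // [x y|i _]; first exact: mulr_ege1.
  rewrite exprn_ege1// /qnum.
  rewrite ler_pdivlMr ?subr_gt0// mul1r lerB//.
  have : (0 < nth 0 n i)%N by apply: (allP npos); rewrite mem_nth// sz.
  case: (nth 0%N n i) => // m _; rewrite exprS ger_pMr//.
  by rewrite exprn_ile1// ltW.
have D0 := lt_le_trans ltr01 D1.
rewrite /qmzv_term; apply/andP; split.
  by rewrite divr_ge0 ?exprn_ge0// ltW.
rewrite ler_pdivrMr//.
apply: le_trans (ler_peMr (exprn_ge0 _ (ltW q0)) D1).
apply: ler_wiXn2l; rewrite ?(ltW q0) ?(ltW q1)//.
case: k k2 sz {npos D1 D0} => // a k /= a2 _.
rewrite big_ord_recl /= nth0.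
by apply: leq_trans (leq_addr _ _); rewrite leq_pmulr// subn_gt0.
Qed.

Lemma qmzv_summable (q : R) (k : seq nat) : 0 < q < 1 -> admissible k ->
  summable (decreasing_seqs (size k)) (fun n => (qmzv_term q k n)%:E).
Proof.
move=> q01 adm; rewrite /summable.
have [r rE] : exists r, size k = r.+1.
  by case: k adm => [|a k] //= _; exists (size k).
have [C HC] := esum_head_fin r q01.
apply: (@le_lt_trans _ _ C%:E); last exact: ltry.
apply: le_trans HC; rewrite -rE; apply: le_esum => n Dn.
have /andP[t0 t1] := qmzv_term_bound q01 adm Dn.
by rewrite abse_EFin lee_fin ger0_norm.
Qed.

End Summability.

(* Main.v *)
(* Write u(n) = q^n/[n] and w_k(n) = q^{n(k-1)}/[n]^k, and attach to an index
   (k_1, ..., k_r) the connected sum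
     S(k_1, ..., k_r) =
       sum_{n_1 > ... > n_r > n_{r+1} > 0} u(n_1 - n_{r+1}) prod_i w_{k_i}(n_i),
   finite as soon as some k_i >= 2.  The partial fraction
     u(a-b) w_k(a) + sum_{j < k-1} w_{k-j}(a) w_{j+1}(b) = w_k(b) (u(a-b) - u(a))
   moves the exponent k from the largest variable a = n_1 to the smallest one
   b = n_{r+1}; summing u(a-b) - u(a) over a > n_2 then telescopes to
   sum_{0 <= l < b} u(n_2 - l), where n_2 is replaced by b when r = 1.  The term l = 0 is
   zeta_q(k_2 + 1, k_3, ..., k_1), and the terms l > 0 form S(k_2, ..., k_r, k_1).
   In the sum over all rotations of the index the S terms cancel. *)
Require Import Defs.
From mathcomp Require Import all_boot all_order all_algebra.
From mathcomp Require Import all_classical all_reals all_analysis.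
From mathcomp Require Import zify ring.

Set Implicit Arguments.
Unset Strict Implicit.
Unset Printing Implicit Defensive.

Import Order.TTheory GRing.Theory Num.Theory.
Import numFieldNormedType.Exports.
Local Open Scope classical_set_scope.
Local Open Scope ring_scope.

(** * One-variable factors and the partial fraction *)

Definition qmzv_slot {R : realType} (q : R) (k n : nat) : R :=
  q ^+ (n * (k - 1)) / qnum q n ^+ k.

Definition qratio {R : realType} (q : R) (n : nat) : R := q ^+ n / qnum q n.

Section Terms.
Variables (R : realType) (q : R).

Lemma qmzv_term_cons a k m n :
  qmzv_term q (a :: k) (m :: n) = qmzv_slot q a m * qmzv_term q k n.
Proof.
by rewrite /qmzv_term /qmzv_slot /= !big_ord_recl /= exprD invfM mulrACA.
Qed.

Lemma qmzv_term_nil n : qmzv_term q [::] n = 1.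
Proof. by rewrite /qmzv_term /= !big_ord0 expr0 invr1 mulr1. Qed.

(** Entries past [size k] are never read. Connected sums rely on this: their sequences are one entry
    longer than the index, and the extra entry enters through [qratio] alone. *)
Lemma qmzv_term_cat k n n' :
  size n = size k -> qmzv_term q k (n ++ n') = qmzv_term q k n.
Proof.
elim: k n => [|a k IH] [|m n] //=; first by rewrite !qmzv_term_nil.
by case=> sz; rewrite !qmzv_term_cons IH.
Qed.

Lemma qmzv_term_rcons k n a m : size n = size k ->
  qmzv_term q (rcons k a) (rcons n m) = qmzv_term q k n * qmzv_slot q a m.
Proof.
elim: k n => [|b k IH] [|p n] //=.
  by rewrite qmzv_term_cons !qmzv_term_nil mulrC.
by case=> sz; rewrite !qmzv_term_cons IH // mulrA.
Qed.

(** The recursion starts at exponent 1: by truncated subtraction, exponents 0 and 1 carry the same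
    power of q. *)
Lemma qmzv_slotS k n : qmzv_slot q k.+2 n = qratio q n * qmzv_slot q k.+1 n.
Proof.
by rewrite /qmzv_slot /qratio !subn1 /= mulnS exprD (exprS _ k.+1) invfM mulrACA.
Qed.

Hypothesis q01 : 0 < q < 1.
Let q0 : 0 < q. Proof. by case/andP: q01. Qed.
Let q1 : q < 1. Proof. by case/andP: q01. Qed.

Lemma qnum_ge1 n : (0 < n)%N -> 1 <= qnum q n.
Proof.
case: n => // n _; rewrite ler_pdivlMr ?subr_gt0// mul1r lerB//.
by rewrite exprS ger_pMr// exprn_ile1// ltW.
Qed.

Lemma qnum_gt0 n : (0 < n)%N -> 0 < qnum q n.
Proof. by move=> n0; apply: lt_le_trans (qnum_ge1 n0). Qed.

Lemma qratio_ge0 n : (0 < n)%N -> 0 <= qratio q n.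
Proof. by move=> n0; rewrite divr_ge0 ?exprn_ge0 ?(ltW q0)// ltW ?qnum_gt0. Qed.

Lemma qratio_le n : (0 < n)%N -> qratio q n <= q ^+ n.
Proof.
by move=> n0; rewrite ler_pdivrMr ?qnum_gt0// ler_peMr ?qnum_ge1 ?exprn_ge0 ?(ltW q0).
Qed.

Lemma qratio_anti m n : (0 < m <= n)%N -> qratio q n <= qratio q m.
Proof.
move=> /andP[m0 mn]; have n0 := leq_trans m0 mn.
have qmn : q ^+ n <= q ^+ m by rewrite ler_wiXn2l ?(ltW q0) ?(ltW q1).
apply: ler_pM => //; first by rewrite exprn_ge0// ltW.
  by rewrite invr_ge0 ltW// qnum_gt0.
rewrite lef_pV2 ?posrE ?qnum_gt0// ler_pM2r ?invr_gt0 ?subr_gt0//.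
by rewrite lerB.
Qed.

(** Induction on k: multiplying the identity for k by u(a) raises every exponent at a by one, and
    the new summand j = k is w_2(a) w_{k+1}(b). After removing w_{k+1}(b), what remains is u(a)
    (u(a-b) - u(a) + 1/[a]) = u(b) (u(a-b) - u(a)). *)
Lemma qratio_partial_fraction k a b : (0 < b < a)%N ->
  qratio q (a - b) * qmzv_slot q k.+1 a
    + \sum_(0 <= j < k) qmzv_slot q (k.+1 - j) a * qmzv_slot q (j + 1) b
  = qmzv_slot q k.+1 b * (qratio q (a - b) - qratio q a).
Proof.
move=> /andP[b0 ba].
have oneBq_neq0 n : (0 < n)%N -> 1 - q ^+ n != 0.
  by move=> n0; rewrite subr_eq0 eq_sym lt_eqF// exprn_ilt1 ?ltW// -lt0n.
have q1' : 1 - q != 0 by rewrite subr_eq0 eq_sym lt_eqF.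
have Aa := oneBq_neq0 a (ltn_trans b0 ba); have Ab := oneBq_neq0 b b0.
(* With this substitution [field] sees q^(a-b) and q^b as independent variables. *)
have qab : q ^+ a = q ^+ (a - b) * q ^+ b by rewrite -exprD subnK// ltnW.
have Aab : 1 - q ^+ (a - b) != 0 by apply: oneBq_neq0; rewrite subn_gt0.
have slot1 n : qmzv_slot q 1 n = (qnum q n)^-1.
  by rewrite /qmzv_slot muln0 expr0 mul1r expr1.
elim: k => [|k IH].
  rewrite big_geq // addr0 !slot1 /qratio /qnum.
  move: Aa; rewrite qab => Aa; field.
  by rewrite q1' Aa Ab Aab.
rewrite big_nat_recr //=.
have -> : \sum_(0 <= j < k) qmzv_slot q (k.+2 - j) a * qmzv_slot q (j + 1) b =
  qratio q a * \sum_(0 <= j < k) qmzv_slot q (k.+1 - j) a * qmzv_slot q (j + 1) b.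
  rewrite mulr_sumr; apply: eq_big_nat => j /andP[_ jk].
  rewrite mulrA; congr (_ * _).
  have -> : (k.+1 - j = (k - j).+1)%N by lia.
  by rewrite -qmzv_slotS; congr (qmzv_slot _ _ _); lia.
have -> : (k.+2 - k = 2)%N by lia.
rewrite !qmzv_slotS addn1.
have -> : qratio q (a - b) * (qratio q a * qmzv_slot q k.+1 a) =
  qratio q a * (qratio q (a - b) * qmzv_slot q k.+1 a) by ring.
rewrite addrA -mulrDr IH slot1.
have -> : qratio q a * (qmzv_slot q k.+1 b * (qratio q (a - b) - qratio q a)) +
    qratio q a * (qnum q a)^-1 * qmzv_slot q k.+1 b =
  qmzv_slot q k.+1 b * (qratio q a * (qratio q (a - b) - qratio q a + (qnum q a)^-1))
  by ring.
rewrite (mulrC (qratio q b)) -[RHS]mulrA; congr (_ * _).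
rewrite /qratio /qnum.
move: Aa; rewrite qab => Aa; field.
by rewrite q1' Aa Ab Aab.
Qed.

(** * Telescoping over the largest variable *)

Lemma cvg_qratio : qratio q n @[n --> \oo] --> 0.
Proof.
apply: (@squeeze_cvgr _ _ _ _ (cst 0) (fun n => q ^+ n)).
- near=> n; have n0 : (0 < n)%N by near: n; exists 1%N.
  by rewrite qratio_ge0 ?qratio_le.
- exact: cvg_cst.
- by apply: cvg_expr; rewrite ger0_norm ?(ltW q0).
Unshelve. all: by end_near. Qed.

Lemma esum_telescope (f : nat -> R) :
  (forall i, f i.+1 <= f i) -> f @ \oo --> 0 ->
  (\esum_(i in [set: nat]) (f i - f i.+1)%:E = (f 0%N)%:E)%E.
Proof.
move=> fS f0; rewrite -nneseries_esumT; last by move=> n; rewrite lee_fin subr_ge0.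
apply/cvg_lim => //.
have -> : (fun n => \sum_(0 <= i < n) (f i - f i.+1)%:E)%E =
    EFin \o (fun n => f 0%N - f n).
  apply/funext => n /=; rewrite sumEFin; congr EFin.
  under eq_bigr do rewrite -opprB.
  by rewrite sumrN telescope_sumr// opprB.
apply: cvg_EFin; first by apply: nearW.
by rewrite -[X in _ --> X]subr0; apply: cvgB => //; exact: cvg_cst.
Qed.

(** The difference u(a-b) - u(a) splits into b consecutive differences. Exchanging the sums, the
    series over a telescopes for each l separately and leaves its first term u(M-l), where M-l > 0
    because l < b <= M. *)
Lemma esum_qratio_sub (c : R) b M : 0 <= c -> (b <= M)%N ->
  (\esum_(a in [set a | (M < a)%N]) (c * (qratio q (a - b) - qratio q a))%:E
   = \sum_(0 <= l < b) (c * qratio q (M - l))%:E)%E.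
Proof.
move=> c0 bM.
rewrite (@reindex_esum _ _ _ [set: nat] _ (fun i => M.+1 + i)%N); last first.
  split=> [i _ /=|i j _ _ /addnI//|a /= Ma]; first by rewrite leq_addr.
  by exists (a - M.+1)%N => //; rewrite subnKC.
pose f l i := c * qratio q (M - l + i)%N.
transitivity (\esum_(i in [set: nat]) \sum_(l < b) (f l i - f l i.+1)%:E)%E.
  apply: eq_esum => i _; rewrite sumEFin; congr EFin.
  (* Increments of [g] in l are the differences [f l i - f l i.+1]. *)
  pose g l := c * qratio q (M.+1 + i - l)%N.
  rewrite mulrBr -{2}[(M.+1 + i)%N]subn0 -(@telescope_sumr _ 0 b g)// big_mkord.
  apply: eq_bigr => l _; have lb := ltn_ord l.
  by rewrite /f /g; congr (_ * qratio _ _ - _ * qratio _ _); lia.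
have f_le (l : 'I_b) i : f l i.+1 <= f l i.
  have lb := ltn_ord l; rewrite ler_wpM2l// qratio_anti//; lia.
rewrite esum_sum => [|i l _ _]; last by rewrite lee_fin subr_ge0 f_le.
rewrite big_mkord; apply: eq_bigr => l _.
rewrite esum_telescope ?/f ?addn0// => [i|]; first exact: f_le.
rewrite -[X in _ --> X](mulr0 c); apply: cvgMr.
under eq_fun do rewrite addnC.
by apply: (cvg_comp _ _ (cvg_addnr (M - l))); exact: cvg_qratio.
Qed.

End Terms.

(** * Splitting off the first or last entry of a decreasing sequence *)

Section Decreasing.
Variables (R : realType) (r : nat) (F : seq nat -> \bar R).
Hypothesis F0 : forall n, decreasing_seqs r.+2 n -> (0 <= F n)%E.

Lemma esum_decreasing_cons :
  (\esum_(n in decreasing_seqs r.+2) F n =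
   \esum_(m in decreasing_seqs r.+1)
     \esum_(a in [set a | (head 0%N m < a)%N]) F (a :: m))%E.
Proof.
have mem a m : decreasing_seqs r.+1 m ->
    (head 0%N m < a)%N -> decreasing_seqs r.+2 (a :: m).
  case: m => [|b m] [//= sz so al] ba; split=> //=; first by rewrite sz.
    by rewrite ba.
  by rewrite al (leq_ltn_trans (leq0n _) ba).
rewrite esum_esum; last by move=> m a Dm am; apply: F0; apply: mem.
rewrite (@reindex_esum _ _ _
  (decreasing_seqs r.+1 `*`` (fun m : seq nat => [set a | (head 0%N m < a)%N])) _
  (fun p => p.2 :: p.1)) //.
split.
- by move=> [m a] /= [Dm am]; apply: mem.
- by move=> [m a] [m' a'] _ _ /= [-> ->].
- move=> [|a [|b m]] [] //= [sz] /andP[ab so] /and3P[a0 b0 al].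
  by exists (b :: m, a) => //; split=> //=; split=> //=; rewrite ?sz ?b0.
Qed.

Lemma esum_decreasing_rcons :
  (\esum_(n in decreasing_seqs r.+2) F n =
   \esum_(m in decreasing_seqs r.+1) \sum_(0 <= l < (last 0%N m).-1) F (rcons m l.+1))%E.
Proof.
have memE m l : decreasing_seqs r.+2 (rcons m l) <->
    decreasing_seqs r.+1 m /\ (0 < l < last 0 m)%N.
  case: m => [|a m]; first by split=> [[]|[[]]].
  split=> [[/=]|[[/=] sz so /andP[a0 al] /andP[l0 lm]]].
    rewrite size_rcons rcons_path all_rcons => -[sz] /andP[so lm] /and3P[a0 l0 al].
    by split; [split; rewrite /= ?sz ?a0|rewrite l0].
  by split; rewrite /= ?size_rcons ?sz ?rcons_path ?so ?all_rcons ?a0 ?l0.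
(* The new last entry is coded as [l.+1], which keeps it positive; it stays below [last 0 m] exactly
   when l lies in [J m], a finite set. *)
pose J (m : seq nat) := `I_(last 0%N m).-1.
have JE (m : seq nat) l : (l < (last 0%N m).-1)%N = (l.+1 < last 0 m)%N by lia.
transitivity (\esum_(m in decreasing_seqs r.+1) \esum_(l in J m) F (rcons m l.+1))%E.
  rewrite esum_esum; last first.
    by move=> m l Dm; rewrite /J/= JE => lm; apply/F0/memE.
  rewrite (@reindex_esum _ _ _ (decreasing_seqs r.+1 `*`` J) _
    (fun p => rcons p.1 p.2.+1)) //.
  split.
  - by move=> [m l] /= [Dm]; rewrite /J/= JE => lm; apply/memE.
  - by move=> [m l] [m' l'] _ _ /= /rcons_inj[-> ->].
  - move=> n; case/lastP: n => [[]//|m l] /memE[Dm /andP[l0 lm]].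
    exists (m, l.-1); rewrite /= ?prednK//; split=> //.
    by rewrite /J /= JE prednK.
apply: eq_esum => m Dm; rewrite esum_fset; [|exact: finite_II|].
  by rewrite big_mkord (fsbig_ord _ _ (fun l => F (rcons m l.+1))).
by move=> l; rewrite inE /J/= JE => lm; apply/F0/memE.
Qed.

End Decreasing.

(** * Connected sums: finiteness and one rotation step *)

Definition qmzv_connected {R : realType} (q : R) (k : seq nat) : \bar R :=
  (\esum_(n in decreasing_seqs (size k).+1)
    (qratio q (head 0%N n - last 0%N n) * qmzv_term q k n)%:E)%E.

Section CyclicSum.
Variables (R : realType) (q : R).
Hypothesis q01 : 0 < q < 1.
Let q0 : 0 < q. Proof. by case/andP: q01. Qed.
Let q1 : q < 1. Proof. by case/andP: q01. Qed.

(** The full power of q is kept because, without admissibility, the entry that is at least 2 may sit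
    anywhere in the index. *)
Lemma qmzv_term_bounds k n : (size k <= size n)%N -> all (fun m => 0 < m)%N n ->
  0 <= qmzv_term q k n <= q ^+ (\sum_(i < size k) nth 0 n i * (nth 0 k i - 1))%N.
Proof.
move=> kn npos.
have D1 : 1 <= \prod_(i < size k) qnum q (nth 0%N n i) ^+ nth 0%N k i.
  apply: (big_ind (fun x : R => 1 <= x)) => // [x y|i _]; first exact: mulr_ege1.
  rewrite exprn_ege1// qnum_ge1//; apply: (allP npos).
  by rewrite mem_nth// (leq_trans (ltn_ord i)).
have D0 := lt_le_trans ltr01 D1.
rewrite /qmzv_term divr_ge0 ?(ltW D0) ?exprn_ge0 ?(ltW q0)//=.
by rewrite ler_pdivrMr// ler_peMr ?exprn_ge0 ?(ltW q0).
Qed.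

Lemma qmzv_term_ge0 k n : (size k <= size n)%N -> all (fun m => 0 < m)%N n ->
  0 <= qmzv_term q k n.
Proof. by move=> kn npos; case/andP: (qmzv_term_bounds kn npos). Qed.

Lemma qmzvE k : admissible k ->
  (\esum_(n in decreasing_seqs (size k)) (qmzv_term q k n)%:E)%E = (qmzv q k)%:E.
Proof.
move=> adm; rewrite /qmzv fineK//.
rewrite (@eq_esum _ _ _ _ (fun n => `|(qmzv_term q k n)%:E|)%E); last first.
  by move=> n /(qmzv_term_bound q01 adm)/andP[t0 _]; rewrite abse_EFin ger0_norm.
by rewrite -summableE; exact: qmzv_summable.
Qed.

Lemma last_decreasing r n i : decreasing_seqs r.+1 n -> (i <= r)%N ->
  (last 0 n <= nth 0 n i)%N.
Proof.
move=> [sz so _] ir; rewrite -nth_last sz /=.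
apply: (@sorted_leq_nth _ geq) => //; rewrite ?inE ?sz//.
- by move=> x y z /= xy yz; exact: leq_trans yz xy.
- by move=> x /=.
- by apply: sub_sorted so => x y /= /ltnW.
Qed.

Lemma head_last_decreasing r n : decreasing_seqs r.+2 n -> (last 0 n < head 0 n)%N.
Proof.
case: n => [|a [|b n]] [] //= [sz] /andP[ba so] /andP[_ al].
apply: leq_ltn_trans ba.
by apply: (@last_decreasing r (b :: n) 0) => //; split=> //=; rewrite sz.
Qed.

Lemma conn_term_ge0 k n : (0 < size k)%N -> decreasing_seqs (size k).+1 n ->
  0 <= qratio q (head 0%N n - last 0%N n) * qmzv_term q k n.
Proof.
case: k => // a k _ Dn; have [sz _ npos] := Dn.
apply: mulr_ge0; first by rewrite qratio_ge0// subn_gt0 (head_last_decreasing Dn).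
by apply: qmzv_term_ge0 => //; rewrite sz.
Qed.

(** If k_i >= 2, the i-th slot yields at least n_i >= n_{r+1} factors q, and u(n_1 - n_{r+1}) is at
    most q^(n_1 - n_{r+1}). Each term is thus at most q^(n_1), which is summable by
    [esum_head_fin]. *)
Lemma qmzv_connected_fin k : has (leq 2) k -> qmzv_connected q k \is a fin_num.
Proof.
move=> k2; have k0 : (0 < size k)%N by case: k k2.
have [C HC] := esum_head_fin (size k) q01.
rewrite ge0_fin_numE; last first.
  by apply: esum_ge0 => n Dn; rewrite lee_fin conn_term_ge0.
apply: le_lt_trans (ltry C); apply: le_trans HC; apply: le_esum => n Dn.
rewrite lee_fin; have [sz _ npos] := Dn.
pose i := find (leq 2) k; have ik : (i < size k)%N by rewrite -has_find.
have ki : (2 <= nth 0 k i)%N := nth_find 0%N k2.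
have hn : (0 < head 0 n - last 0 n)%N.
  rewrite subn_gt0; case: (size k) k0 Dn => // r _; exact: head_last_decreasing.
have /andP[t0 tle] := @qmzv_term_bounds k n (ltnW (eq_leq (esym sz))) npos.
apply: le_trans (ler_pM (qratio_ge0 q01 hn) t0 (qratio_le q01 hn) tle) _.
rewrite -exprD; apply: ler_wiXn2l; rewrite ?(ltW q0) ?(ltW q1)//.
have li := last_decreasing Dn (ltnW ik).
rewrite (bigD1 (Ordinal ik)) //= -leq_subLR.
apply: leq_trans _ (leq_addr _ _).
apply: leq_trans _ (leq_pmulr _ _); last by rewrite subn_gt0.
by apply: leq_trans _ li; rewrite subKn //; apply: ltnW; rewrite -subn_gt0.
Qed.

(** Both sides evaluate the sum of [G]: the left one by partial fractions term by term, the right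
    one by summing over the largest variable first. All terms are nonnegative, so this holds in the
    extended reals before finiteness is known. Taking the head of [rcons k p.+1] also covers empty
    [k]. *)
Lemma qmzv_connected_rot p k : is_index k ->
  (qmzv_connected q (p.+1 :: k)
     + \sum_(0 <= j < p) (qmzv q ((p.+1 - j)%N :: k ++ [:: (j + 1)%N]))%:E
   = (qmzv q ((head 0%N (rcons k p.+1) + 1)%N :: behead (rcons k p.+1)))%:E
     + qmzv_connected q (rcons k p.+1))%E.
Proof.
move=> kpos.
(* The factor independent of the largest variable; its last slot w_{p+1} sits at the smallest
   variable. *)
pose c m := qmzv_term q (rcons k p.+1) m.
have c_ge0 m : decreasing_seqs (size k).+1 m -> 0 <= c m.
  by move=> [sz _ mpos]; apply: qmzv_term_ge0 => //; rewrite size_rcons sz.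
pose G n := c (behead n) * (qratio q (head 0%N n - last 0%N n) - qratio q (head 0%N n)).
transitivity (\esum_(n in decreasing_seqs (size k).+2) (G n)%:E)%E.
  have adm j : (j < p)%N -> admissible ((p.+1 - j)%N :: k ++ [:: (j + 1)%N]).
    by move=> jp; move: kpos; rewrite /admissible /is_index /= all_cat => -> /=; lia.
  have szj j : size ((p.+1 - j)%N :: k ++ [:: (j + 1)%N]) = (size k).+2.
    by rewrite /= size_cat /= addn1.
  rewrite big_mkord.
  under eq_bigr => j _ do rewrite -(qmzvE (adm j (ltn_ord j))) szj.
  rewrite -esum_sum => [|n j Dn _]; last first.
    by case: Dn => sz _ npos; rewrite lee_fin qmzv_term_ge0// szj sz.
  rewrite -esumD; last 2 first.
  - by move=> n Dn; rewrite lee_fin conn_term_ge0.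
  - move=> n Dn; rewrite sumEFin lee_fin; apply: sumr_ge0 => j _.
    by case: Dn => sz _ npos; rewrite qmzv_term_ge0// szj sz.
  apply: eq_esum => n Dn; rewrite sumEFin -EFinD; congr EFin.
  have lh := head_last_decreasing Dn.
  case: n Dn lh => [|a n]; first by case.
  case/lastP: n => [|n b]; first by case.
  move=> [/= [sz] _ /andP[_]]; rewrite all_rcons last_rcons => /andP[b0 _] ba.
  move: sz; rewrite size_rcons => -[sz].
  rewrite /G /c /= last_rcons qmzv_term_cons -cats1 qmzv_term_cat// cats1.
  under eq_bigr => j _ do rewrite qmzv_term_cons cats1 qmzv_term_rcons//.
  rewrite qmzv_term_rcons// -mulrA -qratio_partial_fraction ?b0// mulrDr.
  rewrite big_mkord mulr_sumr.
  by congr (_ + _); [ring|apply: eq_bigr => j _; ring].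
(* Now the largest variable is summed out, with M = [head 0 m] and b = [last 0 m]. *)
rewrite esum_decreasing_cons => [|n Dn]; last first.
  have lh := head_last_decreasing Dn; rewrite lee_fin /G mulr_ge0//.
    apply: c_ge0; case: n Dn {lh} => [|a [|b n]] [] //= [sz] /andP[_ so] /andP[_ al].
    by split=> //=; rewrite sz.
  by rewrite subr_ge0 qratio_anti//; lia.
transitivity (\esum_(m in decreasing_seqs (size k).+1)
    ((qratio q (head 0%N m) * c m)%:E
      + \sum_(0 <= l < (last 0%N m).-1) (qratio q (head 0%N m - l.+1) * c m)%:E))%E.
  apply: eq_esum => m Dm.
  have lh : (last 0 m <= head 0 m)%N by rewrite -nth0; exact: last_decreasing Dm _.
  have l0 : (0 < last 0 m)%N.
    by case: m Dm {lh} => [[]//|a m] [_ _ /allP]; apply; exact: mem_last.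
  rewrite (@eq_esum _ _ _ _
    (fun a => (c m * (qratio q (a - last 0%N m) - qratio q a))%:E)); last first.
    by case: m Dm {lh l0} => [|b m] []//.
  rewrite esum_qratio_sub ?c_ge0//.
  (* The l = 0 term separates from the others, which are reindexed by [l.+1]. *)
  rewrite -{1}(prednK l0) big_nat_recl// subn0 mulrC; congr (_ + _)%E.
  by apply: eq_bigr => l _; rewrite mulrC.
rewrite esumD; last 2 first.
- move=> m Dm; rewrite lee_fin mulr_ge0 ?c_ge0// qratio_ge0//.
  by case: m Dm => [|a m] [] //= _ _ /andP[].
- move=> m Dm; rewrite sumEFin lee_fin big_nat; apply: sumr_ge0 => l lm.
  rewrite mulr_ge0 ?c_ge0// qratio_ge0//.
  have : (last 0 m <= head 0 m)%N by rewrite -nth0; exact: last_decreasing Dm _.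
  lia.
(* For l = 0 the factor u at the head raises the first exponent by one; for l > 0 the number l
   becomes the smallest variable of the rotated connected sum. *)
congr (_ + _)%E.
  have : is_index (rcons k p.+1) by rewrite /is_index all_rcons.
  have := size_rcons k p.+1; rewrite /c => {G c_ge0 c}.
  case: (rcons k p.+1) => [//|h k'] [szk'] /andP[h0 k'0].
  rewrite -qmzvE; last by rewrite addn1; apply/andP.
  rewrite /= szk'; apply: eq_esum => -[|a m] [//_ _ _]; congr EFin.
  case: h h0 => // h _.
  by rewrite !qmzv_term_cons addn1 qmzv_slotS mulrA.
rewrite /qmzv_connected size_rcons esum_decreasing_rcons; last first.
  move=> n; rewrite -[(size k).+1](size_rcons k p.+1) => Dn.
  by rewrite lee_fin conn_term_ge0// size_rcons.
apply: eq_esum => m Dm; apply: eq_bigr => l _; congr EFin.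
rewrite last_rcons -cats1 qmzv_term_cat; last by case: Dm; rewrite size_rcons.
by case: m Dm => [|a m] [].
Qed.

(** * Summing over all rotations *)

Lemma sum_rotS (G : seq nat -> R) (k : seq nat) :
  \sum_(i < size k) G (rot i.+1 k) = \sum_(i < size k) G (rot i k).
Proof.
(* Both sides become the sum over 0 <= i <= [size k], whose extreme terms agree since a full
   rotation is trivial. *)
apply: (addrI (G (rot 0 k))).
rewrite -(big_ord_recl _ (fun i => G (rot i k))) big_ord_recr /=.
by rewrite rot_size rot0 addrC.
Qed.

End CyclicSum.

Theorem theorem1 (R : realType) (q : R) (hq : 0 < q < 1)
    (k : seq nat) (hk : is_index k)
    (hk2 : exists i : 'I_(size k), (2 <= nth 0 k i)%N) :
  \sum_(i < size k)
     qmzv q ((nth 0%N k i + 1)%N :: drop i.+1 k ++ take i k)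
  = \sum_(i < size k) \sum_(0 <= j < nth 0%N k i - 1)
      qmzv q ((nth 0%N k i - j)%N
                :: drop i.+1 k ++ take i k ++ [:: (j + 1)%N]).
Proof.
have hask : has (leq 2) k.
  by case: hk2 => i ki; apply/(has_nthP 0%N); exists i.
pose up s := qmzv q ((head 0%N s + 1)%N :: behead s).
pose split_head s := \sum_(0 <= j < head 0%N s - 1)
  qmzv q ((head 0%N s - j)%N :: behead s ++ [:: (j + 1)%N]).
have rotE (i : 'I_(size k)) : rot i k = nth 0%N k i :: drop i.+1 k ++ take i k.
  by rewrite /rot (drop_nth 0%N).
transitivity (\sum_(i < size k) up (rot i k)).
  by apply: eq_bigr => i _; rewrite rotE.
transitivity (\sum_(i < size k) split_head (rot i k)); last first.
  by apply: eq_bigr => i _; rewrite rotE /split_head /=;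
    under [RHS]eq_bigr do rewrite catA.
(* An entry at least 2 survives rotation, so all these connected sums are finite and can be
   cancelled as real numbers. *)
pose conn s := fine (qmzv_connected q s).
have step (i : 'I_(size k)) :
    conn (rot i k) + split_head (rot i k) = up (rot i.+1 k) + conn (rot i.+1 k).
  have fin j : qmzv_connected q (rot j k) \is a fin_num
    by rewrite qmzv_connected_fin// has_rot.
  apply: EFin_inj; rewrite 2!EFinD !(fineK (fin _)) rotS// /split_head -sumEFin.
  have : is_index (rot i k) by rewrite /is_index (eq_all_r (mem_rot i k)).
  rewrite rotE rot1_cons; set s := drop _ _ ++ _.
  case: (nth 0%N k i) => // p /andP[_ spos].
  by rewrite /= subn1; exact: qmzv_connected_rot.
(* With the connected sums added to both sides and the left side shifted by one rotation, the
   equality is [step] term by term. *)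
apply: (addIr (\sum_(i < size k) conn (rot i k))).
rewrite -[in LHS](sum_rotS up) -[in LHS](sum_rotS conn) -!big_split /=.
by apply: eq_bigr => i _; rewrite -step addrC.
Qed.
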